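(* Let $\mathfrak{A}$ be a finite algebra with $|A|\geq2$ that has almost minimal spectrum. Then the variety generated by $\mathfrak{A}$ is congruence permutable.
   Context: A finite algebra $\mathfrak{A}$ has almost minimal spectrum iff every subalgebra of every finite power $\mathfrak{A}^n$ has cardinality a power of $|A|$. A variety is congruence permutable iff in each of its algebras any two congruences $\psi,\theta$ satisfy $\psi\cdot\theta=\theta\cdot\psi$ (relational product). *)

(* Defs.v *)
From Corelib Require Import RelationClasses.
From mathcomp Require Import all_boot.

Set Implicit Arguments.
Unset Strict Implicit.
Unset Printing Implicit Defensive.

Record signature := Signature { op : Type; arity : op -> nat }.

Definition operations (S : signature) (T : Type) : Type :=
  forall f : op S, {ffun 'I_(arity f) -> T} -> T.

Record algebra (S : signature) := Algebra {
  carrier :> Type;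
  interp : operations S carrier
}.

Definition homomorphism (S : signature) (A B : algebra S) (h : A -> B) : Prop :=
  forall (f : op S) (a : {ffun 'I_(arity f) -> A}),
    h (interp a) = interp [ffun i => h (a i)].

Definition subuniverse (S : signature) (A : algebra S) (P : A -> Prop) : Prop :=
  forall (f : op S) (a : {ffun 'I_(arity f) -> A}),
    (forall i, P (a i)) -> P (interp a).

Definition subalgebra (S : signature) (A : algebra S) (P : A -> Prop)
    (subP : subuniverse P) : algebra S :=
  @Algebra S {x : A | P x} (fun f a =>
    exist P (interp [ffun i => sval (a i)])
      (subP f _ (fun i => eq_ind_r P (svalP (a i)) (ffunE _ i)))).

Definition product (S : signature) (I : Type) (A : I -> algebra S) : algebra S :=
  @Algebra S (forall i, A i) (fun f a i => interp [ffun j => a j i]).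

(* The finite power A^n; {ffun 'I_n -> A} replaces 'I_n -> A so that the
   carrier is a finType whenever A is. *)
Definition power (S : signature) (A : algebra S) (n : nat) : algebra S :=
  @Algebra S {ffun 'I_n -> A} (fun f a => [ffun i => interp [ffun j => a j i]]).

(* As usual, the universe of a subalgebra is nonempty: in a signature without
   constants the empty set is a subuniverse, but not a subalgebra. *)
Record variety (S : signature) (K : algebra S -> Prop) : Prop := Variety {
  variety_H : forall (A B : algebra S) (h : A -> B),
    homomorphism h -> (forall y, exists x, h x = y) -> K A -> K B;
  variety_S : forall (A : algebra S) (P : A -> Prop) (subP : subuniverse P),
    (exists x, P x) -> K A -> K (subalgebra subP);
  variety_P : forall (I : Type) (A : I -> algebra S),
    (forall i, K (A i)) -> K (product A)
}.

Definition generated_variety (S : signature) (A : algebra S) : algebra S -> Prop :=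
  fun B => forall K : algebra S -> Prop, variety K -> K A -> K B.

Record congruence (S : signature) (A : algebra S) (theta : A -> A -> Prop) : Prop :=
  Congruence {
    congruence_equiv : Equivalence theta;
    congruence_compat : forall (f : op S) (a b : {ffun 'I_(arity f) -> A}),
      (forall i, theta (a i) (b i)) -> theta (interp a) (interp b)
  }.

Definition relprod (T : Type) (psi theta : T -> T -> Prop) : T -> T -> Prop :=
  fun x z => exists y, psi x y /\ theta y z.

Definition congruence_permutable (S : signature) (K : algebra S -> Prop) : Prop :=
  forall A : algebra S, K A ->
  forall psi theta : A -> A -> Prop, congruence psi -> congruence theta ->
  forall x y : A, relprod psi theta x y <-> relprod theta psi x y.

(* The exponent 0 is allowed: one-element subalgebras are not excluded. *)
Definition almost_minimal_spectrum (S : signature) (A : finType)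
    (opA : operations S A) : Prop :=
  forall (n : nat) (B : {set {ffun 'I_n -> A}}),
    B != set0 ->
    @subuniverse S (power (Algebra opA) n) (fun x => x \in B) ->
    exists k : nat, #|B| = #|A| ^ k.

(* Main.v *)
(** Let F be the set of ternary term operations of A, a subpower of A, and let
    alpha, beta be its congruences "equal after identifying the first two
    variables" and "equal after identifying the last two".  For a pair p in
    beta let d(p) be the number of pairs in beta that are alpha-related to p in
    both components.  For every k the sum of d(p)^k over p in beta is the
    cardinality of a subpower, hence a power of |A|, and this forces d to be
    constant.  If u, u' are alpha-blocks and n(u,v) is the size of the
    intersection of u with the beta-block v, then d(p) is the sum over v of
    n(u,v) n(u',v); constancy of d and the equality case of Cauchy-Schwarz give
    n(u,v) = n(u',v) whenever u and u' are joined by beta.  Thus alpha and beta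
    permute, which yields a Maltsev term. *)
Require Import Defs.
From mathcomp Require Import all_boot boolp.
From mathcomp Require Import zify.

Set Implicit Arguments.
Unset Strict Implicit.
Unset Printing Implicit Defensive.

(** * Power sums that are powers of a fixed integer *)

Section PowerSums.
Variables (X : finType) (D : {set X}) (d : X -> nat).

Definition power_sum (k : nat) : nat := \sum_(x in D) d x ^ k.

Hypothesis d_gt0 : forall x, x \in D -> 0 < d x.

(** This is [2 * (d x * r) <= d x ^ 2 + r ^ 2] weighted by [d x ^ k] and summed; the weights are
    positive, so equality forces [d x = r] termwise. *)
Lemma power_sum_AGM (r k : nat) :
  2 * r * power_sum k.+1 <= power_sum k.+2 + r ^ 2 * power_sum k
    ?= iff [forall (x | x \in D), d x == r].
Proof.
rewrite /power_sum !big_distrr -big_split /=; apply: leqif_sum => x xD.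
have -> : 2 * r * d x ^ k.+1 = d x ^ k * (2 * (d x * r)) by rewrite expnS; lia.
have -> : d x ^ k.+2 + r ^ 2 * d x ^ k = d x ^ k * (d x ^ 2 + r ^ 2).
  by rewrite !expnS; lia.
have [le_sq eq_sq] := nat_Cauchy (d x) r.
split; first by rewrite leq_mul2l le_sq orbT.
by rewrite eqn_pmul2l ?expn_gt0 ?d_gt0.
Qed.

(* The exponents e k of the power sums form a convex sequence with bounded
   increments, so two consecutive increments agree; this is the equality case
   of the AGM inequality. *)
Lemma power_sums_powers_const (m : nat) :
  1 < m -> D != set0 -> (forall k, exists e, power_sum k = m ^ e) ->
  exists r, forall x, x \in D -> d x = r.
Proof.
move=> m_gt1 /set0Pn[x0 x0D] powS.
have {powS} [e eE] := choice powS.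
have S_gt0 k : 0 < power_sum k by rewrite eE expn_gt0 ltnW.
have leS k : power_sum k <= power_sum k.+1.
  apply: leq_sum => x xD; rewrite expnS leq_pmull //.
  exact: d_gt0.
have le_e k : e k <= e k.+1 by rewrite -(leq_exp2l _ _ m_gt1) -!eE.
pose f k := e k.+1 - e k.
have stepS k : power_sum k.+1 = m ^ f k * power_sum k.
  by rewrite !eE -expnD subnK.
pose M := \max_(x in D) d x.
(* As [d] is at most [M], the ratio [m ^ f k] of consecutive power sums is at most [M]. *)
have f_lt k : f k < M.
  apply: leq_trans (ltn_expl _ m_gt1) _.
  rewrite -(leq_pmul2r (S_gt0 k)) -stepS /power_sum big_distrr /=.
  apply: leq_sum => x xD; rewrite expnS leq_mul2r; apply/orP; right.
  exact: (leq_bigmax_cond (F := d)).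
(* Take [r] in the AGM inequality to be the ratio [m ^ f k]: then [r ^ 2 * power_sum k] is
   [r * power_sum k.+1], which cancels half of the left side. *)
have le_f k : f k <= f k.+1.
  rewrite -(leq_exp2l _ _ m_gt1) -(leq_pmul2r (S_gt0 k.+1)) -stepS.
  have [+ _] := power_sum_AGM (m ^ f k) k.
  by rewrite -mulnn -[_ * _ * power_sum k]mulnA -stepS; lia.
have [k fk] : exists k, f k.+1 = f k.
  apply: contrapT => no_k.
  have f_ge k : k <= f k.
    elim: k => // k IHk; apply: leq_ltn_trans IHk _.
    rewrite ltn_neqAle le_f andbT; apply/eqP => fk.
    by apply: no_k; exists k.
  by have := leq_ltn_trans (f_ge M) (f_lt M); rewrite ltnn.
exists (m ^ f k) => x xD.
have [_] := power_sum_AGM (m ^ f k) k.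
rewrite (_ : _ == _) => [/esym/forallP/(_ x)|]; first by rewrite xD => /eqP.
by apply/eqP; rewrite (stepS k.+1) fk (stepS k) expnS expn1; lia.
Qed.

End PowerSums.

(** * Ternary terms and Maltsev's condition *)

Section Terms.
Variable S : signature.

Inductive ternary_term : Type :=
| Var1 | Var2 | Var3
| App (f : op S) (args : 'I_(arity f) -> ternary_term).

Fixpoint eval (B : algebra S) (t : ternary_term) (x y z : B) : B :=
  match t with
  | Var1 => x
  | Var2 => y
  | Var3 => z
  | App f args => interp [ffun i => eval (args i) x y z]
  end.

Lemma eval_hom (B C : algebra S) (h : B -> C) (t : ternary_term) (x y z : B) :
  homomorphism h -> h (eval t x y z) = eval t (h x) (h y) (h z).
Proof.
move=> hom_h; elim: t => //= f args IH; rewrite hom_h; congr interp.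
by apply/ffunP => i; rewrite !ffunE IH.
Qed.

Lemma eval_congruence (B : algebra S) (theta : B -> B -> Prop) t x y z x' y' z' :
  congruence theta -> theta x x' -> theta y y' -> theta z z' ->
  theta (eval t x y z) (eval t x' y' z').
Proof.
move=> congr_theta xx' yy' zz'; elim: t => //= f args IH.
by apply: (congruence_compat congr_theta) => i; rewrite !ffunE.
Qed.

Definition maltsev (t : ternary_term) (B : algebra S) : Prop :=
  forall x y : B, eval t x x y = y /\ eval t x y y = x.

Lemma variety_maltsev (t : ternary_term) : variety (maltsev t).
Proof.
split.
- move=> B C h hom_h surj_h maltB x y.
  have [[x' <-] [y' <-]] := (surj_h x, surj_h y).
  by rewrite -!(eval_hom _ _ _ _ hom_h) !(maltB x' y').1 !(maltB x' y').2.
- move=> B P subP _ maltB x y.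
  have hom_sval : homomorphism (A := subalgebra subP) (B := B) sval by [].
  have sval_inj (u v : {x | P x}) : sval u = sval v -> u = v.
    by case: u v => [u Pu] [v Pv] /= uv; exact: eq_exist.
  by split; apply: sval_inj; rewrite (eval_hom _ _ _ _ hom_sval);
    have [] := maltB (sval x) (sval y).
- move=> I B maltB x y.
  have hom_i i : homomorphism (A := product B) (B := B i) (fun u => u i) by [].
  by split; apply: functional_extensionality_dep => i;
    rewrite (eval_hom _ _ _ _ (hom_i i)); have [] := maltB i (x i) (y i).
Qed.

Lemma maltsev_permutable (t : ternary_term) : congruence_permutable (maltsev t).
Proof.
move=> B maltB.
have half (psi theta : B -> B -> Prop) : congruence psi -> congruence theta ->
    forall x z, relprod psi theta x z -> relprod theta psi x z.
  (* Compare [t x y z] with [t x y y = x] modulo [theta] and with [t y y z = z] modulo [psi]. *)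
  move=> cpsi ctheta x z [y [xy yz]]; exists (eval t x y z).
  have [psiR _ _] := congruence_equiv cpsi.
  have [thetaR _ _] := congruence_equiv ctheta.
  split.
    rewrite -{1}(maltB x y).2; apply: eval_congruence => //; exact: thetaR.
  rewrite -{2}(maltB y z).1; apply: eval_congruence => //; exact: psiR.
by move=> psi theta cpsi ctheta x y; split; apply: half.
Qed.

End Terms.

(** * Subpowers over arbitrary finite index types *)

Section Subpowers.
Variables (S : signature) (A : finType) (opA : operations S A).

Definition ffun_algebra (I : finType) : algebra S :=
  @Algebra S {ffun I -> A} (fun f a => [ffun i => opA [ffun j => a j i]]).

Definition subpower (I : finType) (B : {set {ffun I -> A}}) : Prop :=
  @subuniverse S (ffun_algebra I) (fun x => x \in B).

Definition reindex (I J : finType) (sigma : J -> I) (x : {ffun I -> A}) :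
  {ffun J -> A} := [ffun j => x (sigma j)].

Lemma reindex_hom (I J : finType) (sigma : J -> I) :
  @homomorphism S (ffun_algebra I) (ffun_algebra J) (reindex sigma).
Proof.
move=> f a; apply/ffunP => j; rewrite !ffunE.
by congr opA; apply/ffunP => i; rewrite !ffunE.
Qed.

Lemma proj_hom (I : finType) (i : I) :
  @homomorphism S (ffun_algebra I) (Algebra opA) (fun x : {ffun I -> A} => x i).
Proof. by move=> f a /=; rewrite ffunE. Qed.

Hypotheses (cardA : 2 <= #|A|) (specA : almost_minimal_spectrum opA).

Lemma card_subpower (I : finType) (B : {set {ffun I -> A}}) :
  B != set0 -> subpower B -> exists k, #|B| = #|A| ^ k.
Proof.
move=> B0 subB; pose phi := reindex (@enum_rank I).
have phi_bij : bijective phi.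
  by exists (reindex enum_val) => x; apply/ffunP => i;
    rewrite !ffunE ?enum_rankK ?enum_valK.
have [psi phiK psiK] := phi_bij.
have phi_on : {on B, bijective phi} by exact: onW_bij.
rewrite -(on_card_preimset phi_on); apply: specA.
  have /set0Pn[x xB] := B0.
  by apply/set0Pn; exists (psi x); rewrite inE psiK.
move=> f a aB; rewrite inE [phi _](reindex_hom (@enum_rank I)).
by apply: subB => j; rewrite ffunE; have := aB j; rewrite inE.
Qed.

(** * Permutability of the kernels of [reindex sigma] and [reindex tau] *)

Section Permute.
Variables (I J : finType) (F : {set {ffun I -> A}}) (sigma tau : J -> I).
Hypothesis subF : subpower F.

Local Notation vec := {ffun I -> A}.

Definition tau_pairs : {set vec * vec} :=
  [set p | [&& p.1 \in F, p.2 \in F & reindex tau p.1 == reindex tau p.2]].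

Definition sigma_block (p : vec * vec) : {set vec * vec} :=
  [set q in tau_pairs | (reindex sigma q.1 == reindex sigma p.1) &&
                        (reindex sigma q.2 == reindex sigma p.2)].

Lemma sigma_block_id p : p \in tau_pairs -> p \in sigma_block p.
Proof. by rewrite [p \in sigma_block p]inE !eqxx => ->. Qed.

(* The k-th power sum counts the (k+1)-tuples of pairs p, q_1, ..., q_k with
   each q_i in the block of p, and these form a subpower of A. *)
Lemma power_sum_sigma_block (k : nat) : tau_pairs != set0 ->
  exists e, power_sum tau_pairs (fun p => #|sigma_block p|) k = #|A| ^ e.
Proof.
move=> C0.
(* A tuple of pairs is flattened into one vector over [A]: [None] marks p, [Some r] marks the r-th
   q, and the Boolean selects the component of the pair. *)
pose row (o : option 'I_k) (b : bool) : {ffun option 'I_k * bool * I -> A} -> vec :=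
  reindex (fun i => (o, b, i)).
pose pairat o z := (row o true z, row o false z).
pose E := [set z | (pairat None z \in tau_pairs) &&
  [forall r, pairat (Some r) z \in sigma_block (pairat None z)]].
pose tuples := [set w : (vec * vec) * {ffun 'I_k -> vec * vec} |
  (w.1 \in tau_pairs) && (w.2 \in ffun_on (sigma_block w.1))].
pose phi z := (pairat None z, [ffun r => pairat (Some r) z]).
have phi_bij : bijective phi.
  pose psi (w : (vec * vec) * {ffun 'I_k -> vec * vec}) :=
    [ffun c : option 'I_k * bool * I =>
      let p := if c.1.1 is Some r then w.2 r else w.1 in
      (if c.1.2 then p.1 else p.2) c.2].
  exists psi => [z|[[x x'] w]].
    by apply/ffunP => -[[[r|] []] i]; rewrite !ffunE /= ?ffunE /= ?ffunE.
  rewrite /phi /pairat; congr (_, _).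
    by congr (_, _); apply/ffunP => i; rewrite !ffunE.
  apply/ffunP => r; rewrite ffunE [RHS]surjective_pairing.
  by congr (_, _); apply/ffunP => i; rewrite !ffunE.
have phi_on : {on tuples, bijective phi} by exact: onW_bij.
have EE : E = phi @^-1: tuples.
  apply/setP => z; rewrite !inE /=; congr (_ && _).
  by apply/forallP/ffun_onP => H r; have := H r; rewrite ffunE.
have -> : power_sum tau_pairs (fun p => #|sigma_block p|) k = #|E|.
  rewrite EE (on_card_preimset phi_on) /power_sum -sum1_card.
  under eq_bigr => p _ do
    rewrite -[k in _ ^ k]card_ord -card_ffun_on -sum1_card.
  by rewrite pair_big_dep /=; apply: eq_bigl => w; rewrite [RHS]inE.
apply: card_subpower.
  have /set0Pn[p pC] := C0; have [psi phiK psiK] := phi_bij.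
  apply/set0Pn; exists (psi (p, [ffun=> p])); rewrite EE !inE psiK /=.
  have := pC; rewrite inE => -> /=.
  by apply/ffun_onP => r; rewrite ffunE sigma_block_id.
(* Membership in [E] combines membership in [F] with equalities between reindexed rows; operations
   preserve both. *)
move=> f a aE.
have row_op o b : row o b (interp (a : {ffun _ -> ffun_algebra _})) =
    interp ([ffun j => row o b (a j)] : {ffun _ -> ffun_algebra I}).
  exact: reindex_hom.
have eq_op (rho : J -> I) (b c : {ffun 'I_(arity f) -> ffun_algebra I}) :
    (forall j, reindex rho (b j) == reindex rho (c j)) ->
    reindex rho (interp b) == reindex rho (interp c).
  move=> bc; rewrite !reindex_hom; apply/eqP; apply: (congr1 (@interp S (ffun_algebra J) f)).
  by apply/ffunP => j; rewrite !ffunE; apply/eqP.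
have C_op o : (forall j, pairat o (a j) \in tau_pairs) ->
    pairat o (interp (a : {ffun _ -> ffun_algebra _})) \in tau_pairs.
  move=> aC; rewrite inE /= !row_op; apply/and3P; split.
  - by apply: subF => j; rewrite ffunE; have := aC j; rewrite inE => /and3P[].
  - by apply: subF => j; rewrite ffunE; have := aC j; rewrite inE => /and3P[].
  - by apply: eq_op => j; rewrite !ffunE; have := aC j; rewrite inE => /and3P[].
have aE0 j : pairat None (a j) \in tau_pairs.
  by have := aE j; rewrite inE => /andP[].
have aEr j r : pairat (Some r) (a j) \in sigma_block (pairat None (a j)).
  by have := aE j; rewrite inE => /andP[_ /forallP].
rewrite inE C_op //=; apply/forallP => r; rewrite inE C_op /=; last first.
  by move=> j; have := aEr j r; rewrite inE => /andP[].
rewrite !row_op; apply/andP; split; apply: eq_op => j; rewrite !ffunE;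
  by have := aEr j r; rewrite inE => /and3P[].
Qed.

(** Kernel blocks are named by their images under [reindex], so the size of a cell is n(u,v). *)
Definition cell (u v : {ffun J -> A}) : {set vec} :=
  [set y in F | (reindex sigma y == u) && (reindex tau y == v)].

(** Sort the pairs of the block by the common value v of [reindex tau]; those with value v form a
    product of two cells. *)
Lemma card_sigma_block p : #|sigma_block p| =
  \sum_v #|cell (reindex sigma p.1) v| * #|cell (reindex sigma p.2) v|.
Proof.
rewrite -sum1_card (partition_big (fun q => reindex tau q.1) predT) //=.
apply: eq_bigr => v _; rewrite -cardsX -sum1_card; apply: eq_bigl => q.
rewrite !inE; have [<-|] := eqVneq (reindex tau q.1) v; rewrite ?andbF //.
rewrite [reindex tau q.2 == _]eq_sym !andbT.
by apply/idP/idP => [/andP[/and3P[-> -> ->] /andP[-> ->]]|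
  /andP[/andP[-> ->] /and3P[-> -> ->]]].
Qed.

(* The inner product of the two vectors of cell sizes equals the squared norm
   of each of them, so the vectors coincide. *)
Lemma cell_const x y : x \in F -> y \in F -> reindex tau x = reindex tau y ->
  forall v, #|cell (reindex sigma x) v| = #|cell (reindex sigma y) v|.
Proof.
move=> xF yF txy.
have xxC : (x, x) \in tau_pairs by rewrite inE /= xF eqxx.
have yyC : (y, y) \in tau_pairs by rewrite inE /= yF eqxx.
have xyC : (x, y) \in tau_pairs by rewrite inE /= xF yF txy eqxx.
have C0 : tau_pairs != set0 by apply/set0Pn; exists (x, x).
have block_gt0 p : p \in tau_pairs -> 0 < #|sigma_block p|.
  by move=> pC; apply/card_gt0P; exists p; exact: sigma_block_id.
have [r rE] := power_sums_powers_const block_gt0 cardA C0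
  (fun k => power_sum_sigma_block k C0).
have := (rE _ xxC, rE _ yyC, rE _ xyC); rewrite !card_sigma_block /=.
move=> [[xxE yyE] xyE] v.
pose n u := #|cell (reindex sigma x) u|; pose n' u := #|cell (reindex sigma y) u|.
(* The summed inequality is an equality, since all three sums are [r]; hence it is an equality at
   each [v]. *)
have [_] := leqif_sum (fun u (_ : true) => nat_Cauchy (n u) (n' u)).
rewrite -big_distrr big_split /=.
have sq (g : {ffun J -> A} -> nat) : \sum_i g i ^ 2 = \sum_i g i * g i.
  by apply: eq_bigr => i _; rewrite mulnn.
rewrite !sq /n /n' xxE yyE xyE mul2n addnn eqxx => /esym/forallP/(_ v).
by move/eqP.
Qed.

(** The wanted [p] lies in a cell that has the same size as the cell containing [x], by [cell_const]
    for [y] and [z]. *)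
Lemma reindex_kernels_permute x y z : x \in F -> y \in F -> z \in F ->
  reindex sigma x = reindex sigma y -> reindex tau y = reindex tau z ->
  exists2 p, p \in F &
    reindex tau p = reindex tau x /\ reindex sigma p = reindex sigma z.
Proof.
move=> xF yF zF sxy tyz.
have : 0 < #|cell (reindex sigma z) (reindex tau x)|.
  rewrite -(cell_const yF zF tyz) -sxy; apply/card_gt0P; exists x.
  by rewrite inE xF !eqxx.
by case/card_gt0P => p; rewrite inE => /and3P[pF /eqP sp /eqP tp]; exists p.
Qed.

End Permute.

Lemma maltsev_term_exists : exists t, maltsev t (Algebra opA).
Proof.
pose T := (A * A * A)%type.
pose X : ffun_algebra T := [ffun i => i.1.1].
pose Y : ffun_algebra T := [ffun i => i.1.2].
pose Z : ffun_algebra T := [ffun i => i.2].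
pose F : {set {ffun T -> A}} := [set x | `[< exists t, x = eval t X Y Z >]].
have inF t : eval t X Y Z \in F by rewrite inE; apply/asboolP; exists t.
have subF : subpower F.
  move=> f a aF; have {aF} : forall j, exists t, a j = eval t X Y Z.
    by move=> j; have := aF j; rewrite inE => /asboolP.
  case/fin_all_exists => args argsE.
  have -> : a = [ffun j => eval (args j) X Y Z].
    by apply/ffunP => j; rewrite ffunE.
  exact: (inF (App args)).
pose sigma (c : A * A) : T := (c.1, c.1, c.2).
pose tau (c : A * A) : T := (c.1, c.2, c.2).
(* The projections [X] and [Y] agree on triples (a,a,b), and [Y] and [Z] on (a,b,b). The resulting
   [p] agrees with [X] on (a,b,b) and with [Z] on (a,a,b), which are the Maltsev identities. *)
have [||p pF [tp sp]] := reindex_kernels_permute (sigma := sigma) (tau := tau)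
  subF (inF (Var1 S)) (inF (Var2 S)) (inF (Var3 S)).
- by apply/ffunP => c; rewrite !ffunE.
- by apply/ffunP => c; rewrite !ffunE.
move: pF; rewrite inE => /asboolP[t pE]; exists t => a b.
have evalE (c : T) : p c = eval (B := Algebra opA) t c.1.1 c.1.2 c.2.
  by rewrite pE (eval_hom _ _ _ _ (proj_hom c)) !ffunE.
move/ffunP: sp => /(_ (a, b)); move/ffunP: tp => /(_ (a, b)).
by rewrite !ffunE !evalE.
Qed.

End Subpowers.

Theorem theorem2p57 (S : signature) (A : finType) (opA : operations S A)
    (cardA : 2 <= #|A|) (specA : almost_minimal_spectrum opA) :
  congruence_permutable (generated_variety (Algebra opA)).
Proof.
have [t maltA] := maltsev_term_exists cardA specA.
move=> B genB; apply: (@maltsev_permutable _ t).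
exact: (genB _ (variety_maltsev t) maltA).
Qed.
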